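(* Let $E$ be a field of characteristic different from $2$. Let $f\in E[X]\setminus E$ be separable and let $g\in E[X]$ be coprime to $f$. Then there exists an absolutely irreducible affine curve $\mathcal{C}$ over $E$ such that the following holds for every field extension $E'/E$: $\mathcal{C}(E')\neq\emptyset$ if and only if there exists $a\in E'$ such that $(X-a)\cdot g$ is a square modulo $f$ in $E'[X]$ and $f(a)\neq 0$.
   Context: A polynomial is separable if it has no multiple roots in an algebraic closure of $E$. A curve over $E$ is absolutely irreducible if it remains irreducible over an algebraic closure of $E$. $\mathcal{C}(E')$ denotes the set of $E'$-rational points of $\mathcal{C}$. A polynomial $h\in E'[X]$ is a square modulo $f$ in $E'[X]$ if $h\equiv s^2 \bmod f$ for some $s\in E'[X]$. *)

(* Defs.v *)
From HB Require Import structures.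
From mathcomp Require Import all_boot all_order all_algebra all_field.
From mathcomp Require Import mpoly.
Set Implicit Arguments.
Unset Strict Implicit.
Unset Printing Implicit Defensive.
Import GRing.Theory.
Local Open Scope ring_scope.

(* Ideals are [Prop]-valued, unlike the boolean ideals of ring_quotient: *)
(* membership in a generated ideal is not decidable for a general ring.  *)

Definition subideal (R : comNzRingType) (I J : R -> Prop) : Prop :=
  forall x, I x -> J x.

Definition ideal_gen (R : comNzRingType) (s : seq R) (x : R) : Prop :=
  exists c : 'I_(size s) -> R, x = \sum_(i < size s) c i * s`_i.

Record prime_ideal (R : comNzRingType) (I : R -> Prop) : Prop := PrimeIdeal {
  prime_ideal0 : I 0;
  prime_idealD : forall x y, I x -> I y -> I (x + y);
  prime_idealM : forall a x, I x -> I (a * x);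
  prime_ideal1 : ~ I 1;
  prime_ideal_or : forall x y, I (x * y) -> I x \/ I y
}.

(* A strict chain P_0 < ... < P_d of prime ideals of R containing I, that is, *)
(* a chain of length d of prime ideals of R / I.                              *)
Definition prime_chain (R : comNzRingType) (I : R -> Prop) (d : nat) : Prop :=
  exists P : 'I_d.+1 -> R -> Prop,
    [/\ forall i, prime_ideal (P i),
        forall i, subideal I (P i)
      & forall i j : 'I_d.+1, (i < j)%N ->
          subideal (P i) (P j) /\ ~ subideal (P j) (P i)].

(* The Krull dimension of R / I is d. *)
Definition quotient_krull_dim (R : comNzRingType) (I : R -> Prop) (d : nat) :
    Prop :=
  prime_chain I d /\ forall e, prime_chain I e -> (e <= d)%N.

(* The closed subscheme of affine n-space over E cut out by finitely many *)
(* polynomials; its coordinate ring is E[X_0, ..., X_(n-1)] / (equations). *)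
Record affine_scheme (E : fieldType) := AffineScheme {
  ambient_dim : nat;
  equations : seq {mpoly E[ambient_dim]}
}.

Section AffineScheme.
Variables (E : fieldType) (C : affine_scheme E).

Definition defining_ideal : {mpoly E[ambient_dim C]} -> Prop :=
  ideal_gen (equations C).

Definition is_curve : Prop := quotient_krull_dim defining_ideal 1.

(* The coordinate ring is a domain: the scheme is irreducible and reduced. *)
Definition irreducible_scheme : Prop := prime_ideal defining_ideal.

Definition base_change (K : fieldType) (iota : {rmorphism E -> K}) :
    affine_scheme K :=
  AffineScheme [seq map_mpoly iota p | p <- equations C].

Definition rational_point (K : fieldType) (iota : {rmorphism E -> K})
    (v : 'I_(ambient_dim C) -> K) : Prop :=
  forall p, p \in equations C -> (map_mpoly iota p).@[v] = 0.

End AffineScheme.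

Arguments rational_point [E] C [K] iota v.

Definition algebraic_closure (E : fieldType) (K : closedFieldType)
    (iota : {rmorphism E -> K}) : Prop :=
  forall x : K, algebraicOver iota x.

Definition absolutely_irreducible (E : fieldType) (C : affine_scheme E) :
    Prop :=
  forall (K : closedFieldType) (iota : {rmorphism E -> K}),
    algebraic_closure iota -> irreducible_scheme (base_change C iota).

Definition square_mod (K : fieldType) (f h : {poly K}) : Prop :=
  exists s : {poly K}, f %| h - s ^+ 2.

(* Main.v *)
Require Import Defs.
From Stdlib Require Import Classical.
From mathcomp Require Import all_boot all_order all_algebra all_field.
From mathcomp Require Import mpoly ring zify.
Set Implicit Arguments.
Unset Strict Implicit.
Unset Printing Implicit Defensive.
Import GRing.Theory.
Local Open Scope ring_scope.

(** Normalise [f] to be monic, of degree [n].  A square root of [(X - a) g]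
    modulo [f] is a polynomial [s] of degree less than [n], so the pairs
    [(a, s)] with [f(a) <> 0] are the points of the affine scheme
    [square_curve]: its coordinates are [a], an inverse [u] of [f(a)] and the
    [n] coefficients of [s], and its equations are [u f(a) = 1] and the
    vanishing of the remainder of [(X - a) g - s^2] modulo [f].  The
    description of its rational points ([square_curve_points]) is then
    immediate; what has to be proved is that it is an absolutely irreducible
    curve.

    Over a field [K] where [f] has roots [r_1, ..., r_n], the values
    [Y_i = s(r_i)] are linear coordinates equivalent to the coefficients of
    [s] (interpolation), and the equations become
    [Y_i^2 = (r_i - a) g(r_i)].  Thus modulo the defining ideal every
    polynomial is a combination of squarefree products of the [Y_i], with
    coefficients in [K[a, 1/f(a)]].  The [r_i] are distinct and
    [g(r_i) <> 0], so no product of a nonempty set of the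
    [(r_i - a) g(r_i)] is a square in [K(a)]; by Kummer theory
    ([kummer_subproduct]), their square roots in an extension [L] of [K(a)]
    generate successive extensions of degree exactly [2], hence the squarefree
    products of square roots are linearly independent over [K(a)].  So the
    defining ideal is the kernel of a morphism to the field [L]
    ([split_function_field]), and is prime.

    For the dimension, the same normal forms show that the polynomials of
    filtration degree at most [D] span, modulo the ideal, a space whose
    dimension is bounded by an affine function of [D].  The [N^2] monomials
    [x^i y^j] with [i, j < N] are therefore linearly dependent for large [N]
    ([algebraic_dependence]): any two elements of the coordinate ring are
    algebraically dependent.  This excludes chains of three primes, by the
    argument behind the Coquand-Lombardi characterisation of Krull dimension:
    if [x] lies in [P1] but not in [P0], and [y] in [P2] but not in [P1], the
    coefficient of the lexicographically lowest monomial of a relation between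
    [x] and [y] would be a unit lying in [P2] ([dependent_krull_dim_le1]).  The
    relation is found over a splitting field [K] of [f] and brought down to [E]
    by an [E]-linear retraction of [K] onto [E].  A chain of two primes is
    given by the generic point and by a closed point of the curve. *)

(** * Adjoining roots *)

Lemma irreducible_factor (F : fieldType) (p : {poly F}) :
  (1 < size p)%N -> exists2 q, irreducible_poly q & q %| p.
Proof.
have [n] := ubnP (size p); elim: n p => // n IHn p le_p_n p_gt1.
have [irr_p|red_p] := classic (irreducible_poly p); first by exists p.
have [q] : exists q : {poly F}, [/\ size q != 1%N, q %| p & ~~ (q %= p)].
  apply: NNPP => no_q; apply: red_p; split=> // q q_neq1 q_p.
  by apply/negPn/negP => q_nassoc; apply: no_q; exists q.
case=> q_neq1 q_p q_nassoc.
have p_neq0 : p != 0 by rewrite -size_poly_gt0 ltnW.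
have q_neq0 : q != 0 by apply: contraTneq q_p => ->; rewrite dvd0p.
have q_gt1 : (1 < size q)%N by rewrite ltn_neqAle eq_sym q_neq1 size_poly_gt0.
have lt_q_p : (size q < size p)%N.
  by rewrite ltn_neqAle dvdp_leq // andbT dvdp_size_eqp.
have [r irr_r r_q] := IHn q (leq_trans lt_q_p le_p_n) q_gt1.
by exists r => //; apply: dvdp_trans q_p.
Qed.

Lemma adjoin_root (F : fieldType) (p : {poly F}) : (1 < size p)%N ->
  exists (L : fieldExtType F) (z : L), root (map_poly (in_alg L) p) z.
Proof.
move=> /irreducible_factor[q /irredp_FAdjoin[L _ [z qz _]] /dvdpP[r ->]].
by exists L, z; rewrite rmorphM rootM qz orbT.
Qed.

(** What brings membership in an extended ideal down to the base field, see
    [retract_ideal_gen]; finite extensions have such a retraction, and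
    retractions compose. *)
Definition retractable (F L : fieldType) (iota : {rmorphism F -> L}) :=
  exists lambda : {additive L -> F},
    lambda 1 = 1 /\ forall c x, lambda (iota c * x) = c * lambda x.

Lemma retractable_in_alg (F : fieldType) (L : fieldExtType F) :
  retractable (in_alg L : {rmorphism F -> L}).
Proof.
pose b := [tuple 1 : L].
have fr_b : free b by rewrite (_ : tval b = [:: 1]) // seq1_free oner_eq0.
exists (coord b ord0 \o projv <<b>>%VS); split=> [|c x] /=.
  rewrite projv_id ?memv_span ?inE // (_ : 1 = b`_0) //.
  by rewrite (@coord_free _ _ 1 b ord0 ord0).
by rewrite /= mulr_algl !linearZ.
Qed.

Lemma splitting_extension (F : fieldType) (p : {poly F}) : p != 0 ->
  exists (L : fieldType) (iota : {rmorphism F -> L}),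
    retractable iota /\
    exists rs : seq L, map_poly iota p %= \prod_(r <- rs) ('X - r%:P).
Proof.
have [n] := ubnP (size p); elim: n F p => // n IHn F p le_p_n p_neq0.
have [p_gt1|p_le1] := ltnP 1 (size p); last first.
  exists F, idfun; split; first by exists idfun.
  exists [::]; rewrite big_nil map_poly_id // -size_poly_eq1 eqn_leq p_le1.
  by rewrite size_poly_gt0.
have [L [z /factor_theorem[q p_eq]]] := adjoin_root p_gt1.
have q_neq0 : q != 0.
  apply: contraNneq p_neq0 => q0; move: p_eq; rewrite q0 mul0r.
  by move/eqP; rewrite map_poly_eq0.
have lt_q_n : (size q < n)%N.
  move: le_p_n; rewrite -(size_map_poly (in_alg L)) p_eq.
  by rewrite size_Mmonic ?monicXsubC // size_XsubC addn2.
have [M [iota [[mu [mu1 muM]] [rs q_eq]]]] := IHn L q lt_q_n q_neq0.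
have [lam [lam1 lamM]] := retractable_in_alg L.
exists M, (iota \o in_alg L); split.
  exists (lam \o mu); split=> [|c x] /=; first by rewrite mu1.
  by rewrite muM lamM.
exists (iota z :: rs); rewrite big_cons mulrC map_poly_comp p_eq rmorphM /=.
by rewrite map_polyXsubC eqp_mulr.
Qed.

Lemma square_roots_extension (F : fieldType) (ds : seq F) :
  exists (L : fieldType) (iota : {rmorphism F -> L}),
    forall d, d \in ds -> exists y, y ^+ 2 = iota d.
Proof.
elim: ds => [|d ds [L [iota sqrt_ds]]]; first by exists F, idfun.
have size_q : size ('X^2 - (iota d)%:P) = 3%N by rewrite size_XnsubC.
have [|M [z]] := @adjoin_root L ('X^2 - (iota d)%:P); first by rewrite size_q.
rewrite /root rmorphB /= map_polyXn map_polyC /= !hornerE subr_eq0.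
move=> /eqP z2; exists M, (in_alg M \o iota) => e; rewrite inE.
case/predU1P=> [->|/sqrt_ds[y y2]]; first by exists z.
by exists (in_alg M y); rewrite /= -y2 -!in_algE rmorphXn.
Qed.

(** * Adjoining square roots *)

(** The combinations of squarefree products of the [Y r], [r] in [l], with
    coefficients in [B].  The recursive form avoids indexing by subsets of [l]:
    every argument below treats one square root at a time. *)
Fixpoint adjoin (R : comNzRingType) (T : Type) (B : R -> Prop) (Y : T -> R)
    (l : seq T) (x : R) : Prop :=
  if l is r :: l' then
    exists u v, [/\ adjoin B Y l' u, adjoin B Y l' v & x = u + v * Y r]
  else B x.

(** The degree [D] serves the dimension count; a mere subring is a constant
    filtration. *)
Record filtered_subring (R : comNzRingType) (B : nat -> R -> Prop) : Prop :=
  FilteredSubring {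
    filtered0 : B 0%N 0;
    filtered1 : B 0%N 1;
    filteredS : forall D x, B D x -> B D.+1 x;
    filteredN : forall D x, B D x -> B D (- x);
    filteredD : forall D x y, B D x -> B D y -> B D (x + y);
    filteredM : forall D1 D2 x y, B D1 x -> B D2 y -> B (D1 + D2)%N (x * y)
  }.

Section Adjoin.
Variables (R : comNzRingType) (T : eqType) (B : nat -> R -> Prop) (Y : T -> R).
Hypothesis B_ring : filtered_subring B.

Lemma filtered_le D1 D2 x : (D1 <= D2)%N -> B D1 x -> B D2 x.
Proof.
move=> /subnK <-; elim: (D2 - D1)%N => // k IHk /IHk; rewrite addSn.
exact: filteredS.
Qed.

Lemma filtered_zero D : B D 0.
Proof. exact: filtered_le (filtered0 B_ring). Qed.

Lemma adjoin_base D l x : B D x -> adjoin (B D) Y l x.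
Proof.
elim: l x => // r l IHl x Bx; exists x, 0.
by split; [apply: IHl | apply: IHl; apply: filtered_zero | rewrite mul0r addr0].
Qed.

Lemma adjoin_gen l r : r \in l -> adjoin (B 0) Y l (Y r).
Proof.
elim: l => // s l IHl; rewrite inE => /predU1P[<-|/IHl Hr].
  exists 0, 1; split; last by rewrite add0r mul1r.
    exact/adjoin_base/(filtered0 B_ring).
  exact/adjoin_base/(filtered1 B_ring).
exists (Y r), 0; split=> //; last by rewrite mul0r addr0.
exact/adjoin_base/(filtered0 B_ring).
Qed.

Lemma adjoin_le D1 D2 l x :
  (D1 <= D2)%N -> adjoin (B D1) Y l x -> adjoin (B D2) Y l x.
Proof.
move=> le_D; elim: l x => [x|r l IHl x [u [v [/IHl Hu /IHl Hv ->]]]].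
  exact: filtered_le.
by exists u, v.
Qed.

Lemma adjoinN D l x : adjoin (B D) Y l x -> adjoin (B D) Y l (- x).
Proof.
elim: l x => [x|r l IHl x [u [v [/IHl Hu /IHl Hv ->]]]]; first exact: filteredN.
by exists (- u), (- v); split=> //; rewrite opprD mulNr.
Qed.

Lemma adjoinD D l x y :
  adjoin (B D) Y l x -> adjoin (B D) Y l y -> adjoin (B D) Y l (x + y).
Proof.
elim: l x y => [x y|r l IHl x y [u [v [Hu Hv ->]]] [u' [v' [Hu' Hv' ->]]]].
  exact: filteredD.
by exists (u + u'), (v + v'); split; [apply: IHl | apply: IHl | ring].
Qed.

Lemma adjoinM_base D1 D2 l x y :
  B D1 x -> adjoin (B D2) Y l y -> adjoin (B (D1 + D2)) Y l (x * y).
Proof.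
move=> Bx; elim: l y => [y|r l IHl y [u [v [/IHl Hu /IHl Hv ->]]]].
  exact: filteredM.
by exists (x * u), (x * v); split=> //; ring.
Qed.

(** Rewriting the square of each [Y r] by an element of degree [1] costs at
    most one degree per generator, which bounds the degree of a product by
    [D1 + D2 + size l]. *)
Lemma adjoinM D1 D2 l x y : {in l, forall r, B 1 (Y r ^+ 2)} ->
  adjoin (B D1) Y l x -> adjoin (B D2) Y l y ->
  adjoin (B (D1 + D2 + size l)) Y l (x * y).
Proof.
elim: l x y => [|r l IHl] x y BY; first by rewrite addn0; apply: filteredM.
move=> [u [v [Hu Hv ->]]] [u' [v' [Hu' Hv' ->]]].
have{}IHl := IHl _ _ (fun s s_l => BY s (mem_behead (s := r :: l) s_l)).
have le1 : (D1 + D2 + size l <= D1 + D2 + size (r :: l))%N.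
  by rewrite leq_add2l leqnSn.
exists (u * u' + Y r ^+ 2 * (v * v')), (u * v' + v * u'); split; last by ring.
  apply: adjoinD; first exact: adjoin_le le1 (IHl _ _ Hu Hu').
  have := adjoinM_base (BY r (mem_head _ _)) (IHl _ _ Hv Hv').
  by rewrite add1n /= addnS.
by apply: adjoin_le le1 _; apply: adjoinD; apply: IHl.
Qed.

Lemma adjoinX D l x k : {in l, forall r, B 1 (Y r ^+ 2)} ->
  adjoin (B D) Y l x -> adjoin (B (k * (D + size l))) Y l (x ^+ k).
Proof.
move=> BY Hx; elim: k => [|k IHk].
  exact: adjoin_base (filtered1 B_ring).
rewrite exprS mulSn addnAC; exact: adjoinM.
Qed.

End Adjoin.

Section Kummer.
Variables (L : fieldType) (T : eqType) (A : L -> Prop) (Y : T -> L).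
Hypothesis A_ring : filtered_subring (fun _ => A).
Hypothesis A_inv : forall x, A x -> A x^-1.

Let adjN l x : adjoin A Y l x -> adjoin A Y l (- x).
Proof. exact: (adjoinN A_ring (D := 0)). Qed.

Let adjD l x y : adjoin A Y l x -> adjoin A Y l y -> adjoin A Y l (x + y).
Proof. exact: (adjoinD A_ring (D := 0)). Qed.

Let adjM l x y : {in l, forall r, A (Y r ^+ 2)} ->
  adjoin A Y l x -> adjoin A Y l y -> adjoin A Y l (x * y).
Proof. exact: (adjoinM A_ring (D1 := 0) (D2 := 0)). Qed.

Let adj_base l x : A x -> adjoin A Y l x.
Proof. exact: (adjoin_base Y A_ring (D := 0)). Qed.

Let adj0 l : adjoin A Y l 0.
Proof. exact/adj_base/(filtered0 A_ring). Qed.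

(** One square root at a time: if [Y r] is new, the conjugate [u - v * Y r] of a
    nonzero element is nonzero, and the product of the two is
    [u ^+ 2 - v ^+ 2 * Y r ^+ 2], where [Y r] does not occur. *)
Lemma adjoinV l x : {in l, forall r, A (Y r ^+ 2)} ->
  adjoin A Y l x -> adjoin A Y l x^-1.
Proof.
elim: l x => [|r l IHl] x AY; first exact: A_inv.
have AYl : {in l, forall r, A (Y r ^+ 2)}.
  by move=> s s_l; apply: AY; rewrite inE s_l orbT.
have{}IHl y := IHl y AYl; have adjMl x y := @adjM l x y AYl.
move=> [u [v [Hu Hv ->]]].
have [Yr_l|nYr_l] := classic (adjoin A Y l (Y r)).
  exists (u + v * Y r)^-1, 0; split=> //; last by rewrite mul0r addr0.
  by apply/IHl/adjD/adjMl.
have [v0|v_neq0] := eqVneq v 0.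
  exists u^-1, 0; rewrite v0 !mul0r !addr0; split=> //; exact: IHl.
have w_neq0 : u - v * Y r != 0.
  apply: contra_not_neq nYr_l => /subr0_eq u_eq.
  by rewrite -(mulKf v_neq0 (Y r)) -u_eq; apply/adjMl/Hu/IHl.
have HN : adjoin A Y l (u ^+ 2 - v ^+ 2 * Y r ^+ 2)^-1.
  apply/IHl/adjD; first exact: adjMl.
  by apply/adjN/adjMl; [apply: adjMl | apply/adj_base/AY/mem_head].
exists (u * (u ^+ 2 - v ^+ 2 * Y r ^+ 2)^-1),
  ((- v) * (u ^+ 2 - v ^+ 2 * Y r ^+ 2)^-1).
split; [exact: adjMl | by apply: adjMl (adjN Hv) HN|].
have -> : u ^+ 2 - v ^+ 2 * Y r ^+ 2 = (u - v * Y r) * (u + v * Y r) by ring.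
have [->|x_neq0] := eqVneq (u + v * Y r) 0; first by rewrite mulr0 !invr0; ring.
by field; rewrite x_neq0 w_neq0.
Qed.

(** The independence of square roots in the form used here: a square root [y]
    of an element of the field [A] becomes expressible through other square
    roots only when it agrees, up to a factor in [A], with a product of some of
    them.  Writing [y = u + v * Y r], the cross term [2 u v (Y r)] of [y ^+ 2]
    must vanish if [Y r] is new, as [2] is invertible; then either [v = 0] and
    [Y r] does not occur, or [u = 0] and [y * Y r] is expressible without
    [Y r]. *)
Lemma kummer_subproduct l y :
  2%:R != 0 :> L -> {in l, forall r, A (Y r ^+ 2)} ->
  A (y ^+ 2) -> adjoin A Y l y ->
  exists m : bitseq, A (y * \prod_(r <- mask m l) Y r).
Proof.
move=> two_neq0; elim: l y => [|r l IHl] y AY Ay2.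
  by move=> Ay; exists [::]; rewrite big_nil mulr1.
have AYl : {in l, forall r, A (Y r ^+ 2)}.
  by move=> s s_l; apply: AY; rewrite inE s_l orbT.
have{}IHl z := IHl z AYl; have adjMl x z := @adjM l x z AYl.
have adjVl z := @adjoinV l z AYl.
have skip z : A (z ^+ 2) -> adjoin A Y l z ->
    exists m : bitseq, A (z * \prod_(s <- mask m (r :: l)) Y s).
  by move=> Az2 /(IHl _ Az2)[m Am]; exists (false :: m).
move=> [u [v [Hu Hv y_eq]]].
have [Yr_l|nYr_l] := classic (adjoin A Y l (Y r)).
  by apply: skip => //; rewrite y_eq; apply/adjD/adjMl.
have [v0|v_neq0] := eqVneq v 0.
  by apply: skip => //; rewrite y_eq v0 mul0r addr0.
have u0 : u = 0.
  apply/eqP; apply: contra_notT nYr_l => u_neq0.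
  (* otherwise the cross term expresses the new square root by old ones *)
  have -> : Y r = (y ^+ 2 - u ^+ 2 - v ^+ 2 * Y r ^+ 2) * (2%:R * (u * v))^-1.
    by rewrite y_eq; field; rewrite u_neq0 v_neq0 two_neq0.
  have Hu2 : adjoin A Y l (u ^+ 2) by apply: adjMl.
  have Hv2 : adjoin A Y l (v ^+ 2) by apply: adjMl.
  have HY2 : adjoin A Y l (Y r ^+ 2) by apply/adj_base/AY/mem_head.
  have H1 : adjoin A Y l 1 := adj_base l (filtered1 A_ring).
  have H2 : adjoin A Y l 2%:R := adjD H1 H1.
  apply: (adjMl); last by apply: adjVl; apply: (adjMl) => //; apply: adjMl.
  apply: adjD; last by apply/adjN/adjMl.
  by apply: adjD; [apply: adj_base | apply: adjN].
have [||m Am] := IHl (y * Y r).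
- rewrite exprMn; apply: (filteredM A_ring (D1 := 0) (D2 := 0)) => //.
  exact/AY/mem_head.
- rewrite y_eq u0 add0r -mulrA; apply: adjMl => //.
  exact/adj_base/AY/mem_head.
by exists (true :: m); rewrite /= big_cons mulrA.
Qed.

End Kummer.

(** * Ideals and algebraic dependence *)

Record ideal (R : comNzRingType) (I : R -> Prop) : Prop := Ideal {
  ideal0 : I 0;
  idealD : forall x y, I x -> I y -> I (x + y);
  idealM : forall a x, I x -> I (a * x)
}.

Section IdealTheory.
Variables (R : comNzRingType) (I : R -> Prop).
Hypothesis I_ideal : ideal I.

Lemma idealN x : I x -> I (- x).
Proof. by rewrite -mulN1r; apply: idealM. Qed.

Lemma idealB x y : I x -> I y -> I (x - y).
Proof. by move=> Ix /idealN; apply: idealD. Qed.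

Lemma ideal_sum (J : Type) (s : seq J) (P : pred J) (F : J -> R) :
  (forall j, P j -> I (F j)) -> I (\sum_(j <- s | P j) F j).
Proof. by move=> IF; apply: big_ind; [case: I_ideal | case: I_ideal |]. Qed.

End IdealTheory.

Lemma prime_ideal_ideal (R : comNzRingType) (P : R -> Prop) :
  prime_ideal P -> ideal P.
Proof. by case. Qed.

Lemma prime_kernel (R : comNzRingType) (L : fieldType)
    (h : {rmorphism R -> L}) : prime_ideal (fun x => h x = 0).
Proof.
split=> [|x y x0 y0|a x x0||x y /eqP]; first exact: rmorph0.
- by rewrite rmorphD x0 y0 addr0.
- by rewrite rmorphM x0 mulr0.
- by move/eqP; rewrite rmorph1 oner_eq0.
by rewrite rmorphM mulf_eq0 => /orP[]/eqP; [left | right].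
Qed.

Section Dependence.
Variables (K : fieldType) (R : comAlgType K) (I : R -> Prop).
Hypothesis I_ideal : ideal I.

Definition spanned m (S : R -> Prop) := exists b : 'I_m -> R,
  forall x, S x -> exists c : 'I_m -> K, I (x - \sum_i c i *: b i).

(** Each generator doubles the number of spanning elements, as the old ones are
    used once as they are and once multiplied by [Y r]. *)
Lemma spanned_adjoin (T : Type) (B : R -> Prop) (Y : T -> R) (l : seq T) m :
  spanned m B -> spanned (2 ^ size l * m) (adjoin B Y l).
Proof.
move=> spanB; elim: l => [|r l [b IHb]]; first by rewrite mul1n.
rewrite /= expnS mul2n -addnn mulnDl; set k := (2 ^ size l * m)%N in b IHb *.
pose b' (i : 'I_(k + k)) :=
  match split i with inl j => b j | inr j => b j * Y r end.
exists b' => x [u [v [/IHb[c Ic] /IHb[d Id] ->]]].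
exists (fun i => match split i with inl j => c j | inr j => d j end).
rewrite big_split_ord /=.
rewrite (eq_bigr (fun i => c i *: b i)) => [|i _]; last first.
  by rewrite /b' (unsplitK (inl i)).
rewrite [X in _ - (_ + X)](eq_bigr (fun i => d i *: b i * Y r)) => [|i _].
  2: by rewrite /b' (unsplitK (inr i)) scalerAl.
rewrite -mulr_suml opprD addrACA -mulrBl mulrC.
by apply: idealD => //; apply: idealM.
Qed.

Lemma spanned_dependence (T : finType) (S : R -> Prop) m (z : T -> R) :
  spanned m S -> (m < #|T|)%N -> (forall t, S (z t)) ->
  exists c : T -> K, (exists t, c t != 0) /\ I (\sum_t c t *: z t).
Proof.
move=> [b span_b] lt_m_T Sz.
have [c Ic] := fin_all_exists (fun t => span_b (z t) (Sz t)).
pose A := \matrix_(i < #|T|, j < m) c (enum_val i) j.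
have : kermx A != 0.
  rewrite -mxrank_eq0 mxrank_ker subn_eq0 -ltnNge.
  exact: leq_ltn_trans (rank_leq_col A) lt_m_T.
case/rowV0Pn=> u /sub_kermxP uA0 u_neq0.
exists (fun t => u ord0 (enum_rank t)); split.
  have [i ui] := rV0Pn _ u_neq0.
  by exists (enum_val i); rewrite enum_valK.
have -> : \sum_t u ord0 (enum_rank t) *: z t =
    \sum_t u ord0 (enum_rank t) *: (z t - \sum_i c t i *: b i).
  rewrite (eq_bigr _ (fun t _ => scalerBr _ _ _)) sumrB.
  rewrite (eq_bigr _ (fun t _ => scaler_sumr _ _ _ _)) exchange_big /=.
  rewrite [X in _ - X]big1 ?subr0 // => i _.
  have /matrixP/(_ ord0 i) := uA0; rewrite !mxE => uA0i.
  rewrite (eq_bigr _ (fun t _ => scalerA _ _ _)) -scaler_suml.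
  rewrite (reindex_omap enum_val (fun t => Some (enum_rank t))) /=; last first.
    by move=> t _; rewrite enum_rankK.
  rewrite (eq_bigl predT) => [|j]; last by rewrite enum_valK eqxx.
  rewrite (eq_bigr (fun j => u ord0 j * A j i)) ?uA0i ?scale0r // => j _.
  by rewrite enum_valK mxE.
by apply: ideal_sum => // t _; rewrite -mulr_algl; apply: idealM.
Qed.

(** The monomials [x ^+ i * y ^+ j] with [i, j < N] have degree linear in [N],
    so they lie in a space of dimension linear in [N], while there are [N ^ 2]
    of them. *)
Lemma algebraic_dependence (T : eqType) (B : nat -> R -> Prop) (Y : T -> R)
    (l : seq T) k :
  filtered_subring B -> (forall D, spanned (k * D).+1 (B D)) ->
  {in l, forall r, B 1%N (Y r ^+ 2)} ->
  (forall x, exists D, adjoin (B D) Y l x) ->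
  forall x y, exists N (c : nat -> nat -> K),
    (exists i j, [/\ (i < N)%N, (j < N)%N & c i j != 0]) /\
    I (\sum_(i < N) \sum_(j < N) c i j *: (x ^+ i * y ^+ j)).
Proof.
move=> B_ring spanB BY B_all x y.
have [D1 Bx] := B_all x; have [D2 By] := B_all y.
set s := size l; pose e := (maxn D1 D2 + s)%N.
have powB z D n : (D + s <= e)%N -> adjoin (B D) Y l z ->
    adjoin (B (n * e)%N) Y l (z ^+ n).
  move=> le_D /(adjoinX B_ring n BY); apply: adjoin_le => //.
  by rewrite leq_mul2l le_D orbT.
(* [e] bounds the degree gained with each factor [x] or [y], and [F] the degree
   of all the monomials; [n] is chosen so that the space of degree [F] has
   dimension at most [n * n.+1], less than the number [n.+1 ^ 2] of
   monomials. *)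
pose n := (2 ^ s * (k * (2 * e + s)).+1)%N.
pose F := (2 * n.+1 * e + s)%N.
have [||c [[[i j] cij] Ic]] := @spanned_dependence ('I_n.+1 * 'I_n.+1)%type
    (adjoin (B F) Y l) _ (fun t => x ^+ t.1 * y ^+ t.2)
    (spanned_adjoin Y l (spanB F)).
- rewrite card_prod card_ord -/s.
  have : (2 ^ s * (k * F).+1 <= n * n.+1)%N.
    rewrite -mulnA leq_mul2l; apply/orP; right; rewrite /F; nia.
  by move/leq_ltn_trans; apply; rewrite ltn_pmul2r.
- move=> [i j] /=.
  apply: adjoin_le (adjoinM B_ring BY (powB _ D1 _ _ Bx) (powB _ D2 _ _ By)).
  + exact: B_ring.
  + rewrite /F; have := ltn_ord i; have := ltn_ord j; nia.
  + by rewrite leq_add2r leq_maxl.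
  + by rewrite leq_add2r leq_maxr.
exists n.+1, (fun i j => c (inord i, inord j)); split.
  by exists i, j; rewrite !inord_val.
rewrite pair_big /= (eq_bigr (fun t => c t *: (x ^+ t.1 * y ^+ t.2))) //.
by case=> a b _; rewrite !inord_val.
Qed.

(** The sum is the product of [x ^+ k] and [w k + x * z] for some [z]; as [x] is
    not in [P], the second factor is in [P], hence in [Q], which contains
    [x]. *)
Lemma lowest_coefficient (P Q : R -> Prop) x N k (w : nat -> R) :
  prime_ideal P -> prime_ideal Q -> subideal P Q -> ~ P x -> Q x ->
  (k < N)%N -> (forall i, (i < k)%N -> w i = 0) ->
  P (\sum_(i < N) x ^+ i * w i) -> Q (w k).
Proof.
move=> primeP primeQ sPQ nPx Qx; elim: k N w => [|k IHk] [|N] w // lt_kN w0.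
  move/sPQ; rewrite big_ord_recl expr0 mul1r.
  under eq_bigr => i _ do rewrite exprS -mulrA.
  rewrite -mulr_sumr => Qsum.
  have -> : w 0%N = w 0%N + x * (\sum_(i < N) x ^+ i * w i.+1) -
      (\sum_(i < N) x ^+ i * w i.+1) * x by ring.
  have idQ := prime_ideal_ideal primeQ.
  by apply: idealB => //; apply: idealM.
rewrite big_ord_recl w0 // mulr0 add0r.
under eq_bigr => i _ do rewrite exprS -mulrA.
rewrite -mulr_sumr => /(prime_ideal_or primeP)[//|].
by apply: (IHk N (fun i => w i.+1)) => // i lt_ik; apply: w0.
Qed.

(** Applying [lowest_coefficient] to [x] in [P0 < P1], then to [y] in [P1 < P2],
    puts the coefficient of the lexicographically lowest monomial of a relation
    into [P2], although it is a nonzero scalar. *)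
Lemma dependent_krull_dim_le1 d :
  (forall x y : R, exists N (c : nat -> nat -> K),
    (exists i j, [/\ (i < N)%N, (j < N)%N & c i j != 0]) /\
    I (\sum_(i < N) \sum_(j < N) c i j *: (x ^+ i * y ^+ j))) ->
  prime_chain I d -> (d <= 1)%N.
Proof.
move=> dep [P [primeP sIP ltP]]; rewrite leqNgt; apply/negP => d_gt1.
pose P_ i := P (inord i).
have [s01 n10] : subideal (P_ 0%N) (P_ 1%N) /\ ~ subideal (P_ 1%N) (P_ 0%N).
  by apply: ltP; rewrite !inordK // ltnW.
have [s12 n21] : subideal (P_ 1%N) (P_ 2%N) /\ ~ subideal (P_ 2%N) (P_ 1%N).
  by apply: ltP; rewrite !inordK // ltnW.
have [x [P1x nP0x]] : exists x, P_ 1%N x /\ ~ P_ 0%N x.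
  apply: NNPP => no_x; apply: n10 => x P1x.
  by apply: NNPP => ?; apply: no_x; exists x.
have [y [P2y nP1y]] : exists y, P_ 2%N y /\ ~ P_ 1%N y.
  apply: NNPP => no_y; apply: n21 => y P2y.
  by apply: NNPP => ?; apply: no_y; exists y.
have [N [c [c_neq0 /(sIP (inord 0))]]] := dep x y.
have row_c : exists i, (i < N)%N && [exists j : 'I_N, c i j != 0].
  have [i [j [lt_iN lt_jN cij]]] := c_neq0; exists i; rewrite lt_iN.
  by apply/existsP; exists (Ordinal lt_jN).
case: (ex_minnP row_c) => i /andP[lt_iN /existsP ci] min_i.
have {ci} col_c : exists j, (j < N)%N && (c i j != 0).
  by case: ci => j cij; exists j; rewrite ltn_ord.
case: (ex_minnP col_c) => j /andP[lt_jN cij] min_j.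
pose w i := \sum_(j < N) c i j *: y ^+ j.
have -> : \sum_(i < N) \sum_(j < N) c i j *: (x ^+ i * y ^+ j) =
    \sum_(i < N) x ^+ i * w i.
  apply: eq_bigr => a _; rewrite mulr_sumr.
  by apply: eq_bigr => b _; rewrite scalerAr.
have w0 a : (a < i)%N -> w a = 0.
  move=> lt_ai; apply: big1 => b _; have [->|cab] := eqVneq (c a b) 0.
    by rewrite scale0r.
  suff : (i <= a)%N by rewrite leqNgt lt_ai.
  by apply: min_i; rewrite (ltn_trans lt_ai) //; apply/existsP; exists b.
move/(lowest_coefficient (primeP _) (primeP _) s01 nP0x P1x lt_iN w0).
rewrite /w; under eq_bigr => b _ do rewrite -mulr_algr.
have c0 b : (b < j)%N -> (c i b)%:A = 0 :> R.
  move=> lt_bj; have [->|cib] := eqVneq (c i b) 0; first by rewrite scale0r.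
  suff : (j <= b)%N by rewrite leqNgt lt_bj.
  by apply: min_j; rewrite (ltn_trans lt_bj).
move/(lowest_coefficient (w := fun b => (c i b)%:A) (primeP _) (primeP _)
  s12 nP1y P2y lt_jN c0).
move/(prime_idealM (primeP _) ((c i j)^-1)%:A).
rewrite -in_algE -in_algE -rmorphM mulVf // rmorph1.
exact: prime_ideal1.
Qed.

End Dependence.

(** * Polynomials and their values *)

(** The values are given by a relation, so that square roots which are only
    known to exist can be interpolated without choosing them beforehand. *)
Lemma interpolation (F : fieldType) (xs : seq F) (Q : F -> F -> Prop) :
  uniq xs -> {in xs, forall x, exists y, Q x y} ->
  exists2 p : {poly F}, (size p <= size xs)%N & {in xs, forall x, Q x p.[x]}.
Proof.
elim: xs => [|x xs IHxs] /=; first by exists 0; rewrite ?size_poly0.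
move=> /andP[x_xs uniq_xs] Qxs.
have [|p size_p Qp] := IHxs uniq_xs.
  by move=> z z_xs; apply: Qxs; rewrite inE z_xs orbT.
pose w := \prod_(z <- xs) ('X - z%:P).
have [y Qy] := Qxs x (mem_head _ _).
have wx_neq0 : w.[x] != 0 by rewrite -rootE root_prod_XsubC.
exists (p + ((y - p.[x]) / w.[x]) *: w) => [|z].
  rewrite (leq_trans (size_polyD _ _)) // geq_max leqW //=.
  by rewrite (leq_trans (size_scale_leq _ _)) // size_prod_XsubC.
rewrite inE hornerD hornerZ => /predU1P[->|z_xs].
  by rewrite divfK // addrC subrK.
have /rootP -> : root w z by rewrite root_prod_XsubC.
by rewrite mulr0 addr0; apply: Qp.
Qed.

(** The coefficients of a polynomial over [R] are [K]-linear combinations of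
    its values at sufficiently many points of [K].  The proof is by Newton's
    divided differences: the quotient [(p - p.[r]) / (X - r)] has one
    coefficient less and its values are again such combinations. *)
Lemma coef_from_values (K : fieldType) (R : comAlgType K) (P : R -> Prop)
    (l : seq K) (p : {poly R}) :
  P 0 -> (forall x y, P x -> P y -> P (x + y)) ->
  (forall c x, P x -> P (c *: x)) ->
  uniq l -> (size p <= size l)%N -> {in l, forall r, P p.[r%:A]} ->
  forall i, P p`_i.
Proof.
move=> P0 PD PZ; have PN x : P x -> P (- x) by rewrite -scaleN1r; apply: PZ.
elim: l p => [|r l IHl] p /=.
  by rewrite leqn0 size_poly_eq0 => _ /eqP-> _ i; rewrite coef0.
move=> /andP[r_l uniq_l] size_p Pp.
have /factor_theorem[q p_eq] : root (p - p.[r%:A]%:P) r%:A.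
  by rewrite /root hornerD hornerN hornerC subrr.
have{}p_eq : p = q * ('X - r%:A%:P) + p.[r%:A]%:P by rewrite -p_eq subrK.
have Pr : P p.[r%:A] by apply/Pp/mem_head.
have size_q : (size q <= size l)%N.
  have [->|q_neq0] := eqVneq q 0; first by rewrite size_poly0.
  move: size_p; rewrite p_eq size_polyDl size_Mmonic ?monicXsubC // size_XsubC.
    by rewrite addn2.
  by rewrite addn2 (leq_ltn_trans (size_polyC_leq1 _)) // ltnS size_poly_gt0.
have Pq i : P q`_i.
  apply: IHl => // s s_l.
  have sr_neq0 : s - r != 0.
    by apply: contraNneq r_l => /subr0_eq <-.
  have -> : q.[s%:A] = (s - r)^-1 *: (p.[s%:A] - p.[r%:A]).
    rewrite [in X in _ *: (X - _)]p_eq !hornerE addrK.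
    rewrite -scalerBl mulr_algr scalerA mulVf ?scale1r //.
  by apply: (PZ); apply: (PD); [apply: Pp; rewrite inE s_l orbT | apply: PN].
move=> i; rewrite p_eq mulrBr !(coefD, coefN) coefMX coefMC coefC mulr_algr.
apply: (PD); first apply: (PD).
- by case: ifP => _ //; apply: Pq.
- exact/PN/PZ/Pq.
- by case: ifP.
Qed.

Lemma fraction_quotient (R : idomainType) (z : {fraction R}) :
  exists p q : R, q != 0 /\ z = FracField.tofrac p / FracField.tofrac q.
Proof.
elim/quotW: z => x; exists (frac x).1, (frac x).2; split.
  exact: denom_ratioP.
unlock FracField.tofrac; rewrite -[X in _ = _ * X]FracField.pi_inv.
rewrite -[RHS]FracField.pi_mul; congr (\pi_({fraction R}))%qT.
rewrite /FracField.mulf /FracField.invf.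
rewrite !numden_Ratio ?oner_neq0 ?denom_ratioP //.
by rewrite mulr1 mul1r Ratio_numden.
Qed.

Section Nonsquare.
Variables (K : fieldType) (g : {poly K}).

(** The polynomial [(r - X) g(r)] in the variable [a], of which the coordinate
    [s(r)] is a square root; [r] is its only root when [g(r) <> 0]. *)
Definition branch (r : K) : {poly K} := (r%:P - 'X) * g.[r]%:P.

Lemma size_branch r : (size (branch r) <= 2)%N.
Proof.
rewrite /branch mulrC mul_polyC (leq_trans (size_scale_leq _ _)) //.
by rewrite -opprB size_polyN size_XsubC.
Qed.

(** As the roots are distinct, the product vanishes to order exactly one at
    [r], whereas the order of a square in the fraction field is even. *)
Lemma nonsquare_branch_prod r (l : seq K) (z : {fraction {poly K}}) :
  uniq (r :: l) -> {in r :: l, forall s, g.[s] != 0} ->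
  z ^+ 2 <> FracField.tofrac (\prod_(s <- r :: l) branch s).
Proof.
move=> uniq_l g_neq0 z2; have [p [q [q_neq0 z_eq]]] := fraction_quotient z.
have prod_eq : \prod_(s <- r :: l) branch s =
    (\prod_(s <- r :: l) - g.[s]) *: \prod_(s <- r :: l) ('X - s%:P).
  rewrite -mul_polyC rmorph_prod -big_split /=; apply: eq_bigr => s _.
  by rewrite /branch polyCN; ring.
have c_neq0 : \prod_(s <- r :: l) - g.[s] != 0.
  by rewrite prodf_seq_neq0; apply/allP => s s_l; rewrite oppr_eq0 g_neq0.
have w_neq0 : \prod_(s <- r :: l) ('X - s%:P) != 0 :> {poly K}.
  by rewrite monic_neq0 // monic_prod_XsubC.
have pq : p ^+ 2 = q ^+ 2 * \prod_(s <- r :: l) branch s.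
  apply/eqP; rewrite -tofrac_eq tofracM !tofracXn -z2 z_eq expr_div_n.
  by rewrite mulrC divfK // expf_neq0 // tofrac_eq0.
have p_neq0 : p != 0.
  rewrite -sqrf_eq0 pq mulf_neq0 ?sqrf_eq0 // prod_eq scaler_eq0 negb_or.
  by rewrite c_neq0.
have /(congr1 (mup r)) := pq; rewrite prod_eq -mul_polyC !expr2.
rewrite !mupM ?mulf_neq0 ?polyC_eq0 // mu_prod_XsubC count_uniq_mem //.
rewrite mem_head [mup r _%:P]mupNroot ?rootC //; lia.
Qed.

End Nonsquare.

(** * Normal forms modulo the equations *)

Section NormalForm.
Variables (K : fieldType) (R : comAlgType K) (I : R -> Prop).
Variables (a u : R) (s : {poly R}) (f g : {poly K}) (rs : seq K).
Hypothesis I_ideal : ideal I.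
Hypothesis uf1 : I (u * horner_alg a f - 1).
Hypothesis s_sqr :
  {in rs, forall r, I (s.[r%:A] ^+ 2 - horner_alg a (branch g r))}.

(** The elements [c(a) / f(a) ^+ D] modulo [I], as [u] stands for [1 / f(a)].
    The bound on [c] has slope [size f], that is, degree of [f] plus one, so
    that multiplying [c] by [f], to raise [D] by one, leaves room for a linear
    factor. *)
Definition fraction_filtration D x := exists2 c : {poly K},
  (size c <= (size f * D).+1)%N & I (x - u ^+ D * horner_alg a c).

Lemma fraction_filtration_ring : filtered_subring fraction_filtration.
Proof.
split.
- exists 0; first by rewrite size_poly0.
  by rewrite rmorph0 mulr0 subrr; apply: ideal0.
- exists 1; first by rewrite size_poly1.
  by rewrite rmorph1 mulr1 subrr; apply: ideal0.
- move=> D x [c size_c Ic]; exists (f * c).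
    by rewrite (leq_trans (size_polyMleq _ _)) // mulnS; lia.
  have -> : x - u ^+ D.+1 * horner_alg a (f * c) =
     (x - u ^+ D * horner_alg a c)
     - (u ^+ D * horner_alg a c) * (u * horner_alg a f - 1).
    by rewrite rmorphM exprS; ring.
  by apply: idealB => //; apply: idealM.
- move=> D x [c size_c Ic]; exists (- c); first by rewrite size_polyN.
  have -> : - x - u ^+ D * horner_alg a (- c) = - (x - u ^+ D * horner_alg a c).
    by rewrite rmorphN; ring.
  exact: idealN.
- move=> D x y [c size_c Ic] [d size_d Id]; exists (c + d).
    by rewrite (leq_trans (size_polyD _ _)) // geq_max size_c.
  have -> : x + y - u ^+ D * horner_alg a (c + d) =
      (x - u ^+ D * horner_alg a c) + (y - u ^+ D * horner_alg a d).
    by rewrite rmorphD; ring.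
  exact: idealD.
- move=> D1 D2 x y [c size_c Ic] [d size_d Id]; exists (c * d).
    by rewrite (leq_trans (size_polyMleq _ _)) // mulnDr; lia.
  have -> : x * y - u ^+ (D1 + D2) * horner_alg a (c * d) =
      y * (x - u ^+ D1 * horner_alg a c) +
      (u ^+ D1 * horner_alg a c) * (y - u ^+ D2 * horner_alg a d).
    by rewrite rmorphM exprD; ring.
  by apply: idealD => //; apply: idealM.
Qed.

(** Polynomials of degree at most one in [a] have filtration degree [1], seen
    as [f(a) c(a) / f(a)]. *)
Lemma fraction_filtration_poly (c : {poly K}) x :
  (size c <= 2)%N -> I (x - horner_alg a c) -> fraction_filtration 1 x.
Proof.
move=> size_c Ic; exists (f * c).
  by rewrite (leq_trans (size_polyMleq _ _)) // muln1; lia.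
have -> : x - u ^+ 1 * horner_alg a (f * c) =
    (x - horner_alg a c) - horner_alg a c * (u * horner_alg a f - 1).
  by rewrite rmorphM expr1; ring.
by apply: idealB => //; apply: idealM.
Qed.

Lemma fraction_filtration_inverse : fraction_filtration 1 u.
Proof.
exists 1; first by rewrite size_poly1.
by rewrite rmorph1 mulr1 expr1 subrr; apply: ideal0.
Qed.

Lemma fraction_filtration_spanned D :
  spanned I (size f * D).+1 (fraction_filtration D).
Proof.
exists (fun i => u ^+ D * a ^+ i) => x [c size_c Ic].
exists (fun i => c`_i); congr (I (x - _)): Ic.
rewrite [horner_alg a c](horner_coef_wide _ (n := (size f * D).+1)).
  rewrite mulr_sumr; apply: eq_bigr => i _.
  by rewrite coef_map /= mulr_algl scalerAr.
by rewrite (leq_trans (size_poly _ _)).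
Qed.

Let B := fraction_filtration.
Let Y r := s.[r%:A].

Lemma square_in_filtration : {in rs, forall r, B 1 (Y r ^+ 2)}.
Proof.
move=> r /s_sqr; apply: fraction_filtration_poly; exact: size_branch.
Qed.

Section Kernel.
Variables (L : fieldType) (iota : {rmorphism {fraction {poly K}} -> L}).
Variable phi : {rmorphism R -> L}.
Hypothesis two_neq0 : 2%:R != 0 :> L.
Hypothesis g_neq0 : {in rs, forall r, g.[r] != 0}.
Hypothesis phi_I : forall x, I x -> phi x = 0.
Hypothesis phi_a : forall c, phi (horner_alg a c) = iota (FracField.tofrac c).

Let A y := exists z, y = iota z.

Let A_ring : filtered_subring (fun _ => A).
Proof.
split.
- by exists 0; rewrite rmorph0.
- by exists 1; rewrite rmorph1.
- by [].
- by move=> _ x [z ->]; exists (- z); rewrite rmorphN.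
- by move=> _ x y [z ->] [w ->]; exists (z + w); rewrite rmorphD.
- by move=> _ _ x y [z ->] [w ->]; exists (z * w); rewrite rmorphM.
Qed.

Let A_inv x : A x -> A x^-1.
Proof. by case=> z ->; exists z^-1; rewrite fmorphV. Qed.

Let phi_uf : phi u * iota (FracField.tofrac f) = 1.
Proof.
have /eqP := phi_I uf1.
by rewrite rmorphB rmorphM rmorph1 subr_eq0 phi_a => /eqP.
Qed.

Let phi_f : iota (FracField.tofrac f) != 0.
Proof.
by apply: contra_eq_neq phi_uf => ->; rewrite mulr0 eq_sym oner_neq0.
Qed.

Let phi_u : phi u = (iota (FracField.tofrac f))^-1.
Proof. by rewrite -[LHS](mulfK phi_f) phi_uf mul1r. Qed.

Let phi_B D x : B D x -> A (phi x).
Proof.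
case=> c _ /phi_I/eqP; rewrite rmorphB subr_eq0 => /eqP ->.
exists ((FracField.tofrac f)^-1 ^+ D * FracField.tofrac c).
by rewrite !rmorphM !rmorphXn /= phi_u phi_a fmorphV.
Qed.

Let phi_adjoin D l x : adjoin (B D) Y l x -> adjoin A (phi \o Y) l (phi x).
Proof.
elim: l x => [|r l IHl] x; first exact: phi_B.
move=> [v [w [/IHl Hv /IHl Hw ->]]].
by exists (phi v), (phi w); rewrite rmorphD rmorphM.
Qed.

Let phi_sqr r :
  r \in rs -> phi (Y r) ^+ 2 = iota (FracField.tofrac (branch g r)).
Proof.
by move=> /s_sqr/phi_I/eqP; rewrite rmorphB rmorphXn subr_eq0 phi_a => /eqP.
Qed.

(** A normal form [v + w * Y r] killed by [phi] has [phi w = 0], and then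
    [phi v = 0]: otherwise the image of [Y r] would be expressible through the
    remaining square roots, and [kummer_subproduct] would make a product of
    distinct branch polynomials a square in the rational function field.  At
    the end of the recursion, a polynomial in [a] is killed only when it is
    zero. *)
Lemma kernel_adjoin D l x : uniq l -> {subset l <= rs} ->
  adjoin (B D) Y l x -> phi x = 0 -> I x.
Proof.
elim: l x => [|r l IHl] x /=.
  move=> _ _ [c _ Ic] phi_x; have := phi_I Ic.
  rewrite rmorphB phi_x rmorphM rmorphXn /= phi_u phi_a => /eqP.
  rewrite sub0r oppr_eq0 mulf_eq0 expf_eq0 invr_eq0 (negPf phi_f) andbF.
  rewrite fmorph_eq0 tofrac_eq0 => /eqP c0.
  by move: Ic; rewrite c0 rmorph0 mulr0 subr0.
move=> /andP[r_l uniq_l] sub_l [v [w [Hv Hw x_eq]]] phi_x.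
have {IHl}IHl y :=
  IHl y uniq_l (fun z z_l => sub_l z (mem_behead (s := r :: l) z_l)).
have AY : {in l, forall z, A ((phi \o Y) z ^+ 2)}.
  move=> z z_l /=; rewrite phi_sqr; last by apply/sub_l/mem_behead.
  by exists (FracField.tofrac (branch g z)).
have [phi_w|phi_w] := eqVneq (phi w) 0.
  have Iw := IHl _ Hw phi_w; rewrite x_eq mulrC.
  apply: idealD => //; last exact: idealM.
  by apply: IHl => //; rewrite -phi_x x_eq rmorphD rmorphM phi_w mul0r addr0.
exfalso.
have r_rs : r \in rs by apply/sub_l/mem_head.
have Yr : adjoin A (phi \o Y) l (phi (Y r)).
  have -> : phi (Y r) = - phi v * (phi w)^-1.
    move: phi_x; rewrite x_eq rmorphD rmorphM => /eqP.
    by rewrite addrC addr_eq0 => /eqP <-; rewrite mulrAC mulfV // mul1r.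
  apply: (adjoinM A_ring (D1 := 0) (D2 := 0)) => //.
    exact/(adjoinN A_ring (D := 0))/phi_adjoin/Hv.
  exact/(adjoinV A_ring A_inv AY)/phi_adjoin/Hw.
have [|m [z z_eq]] := kummer_subproduct A_ring A_inv two_neq0 AY _ Yr.
  by rewrite phi_sqr //; exists (FracField.tofrac (branch g r)).
have sub_m : {subset r :: mask m l <= rs}.
  move=> y; rewrite inE => /predU1P[->//|/mem_mask y_l].
  by apply/sub_l/mem_behead.
apply: (@nonsquare_branch_prod K g r (mask m l) z).
- by rewrite /= mask_uniq // andbT; apply: contra r_l => /mem_mask.
- by move=> y /sub_m; apply: g_neq0.
have {}z_eq : iota z = \prod_(y <- r :: mask m l) (phi \o Y) y.
  by rewrite big_cons -z_eq.
apply: (fmorph_inj iota); rewrite rmorphXn /= z_eq -prodrXl !rmorph_prod /=.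
by apply: eq_big_seq => y /sub_m; apply: phi_sqr.
Qed.

End Kernel.
End NormalForm.

(** * The curve *)

Lemma ideal_gen_ideal (R : comNzRingType) (s : seq R) : ideal (ideal_gen s).
Proof.
split.
- by exists (fun _ => 0); rewrite big1 // => i _; rewrite mul0r.
- move=> x y [c ->] [d ->]; exists (fun i => c i + d i).
  by rewrite -big_split; apply: eq_bigr => i _; rewrite mulrDl.
- move=> a x [c ->]; exists (fun i => a * c i).
  by rewrite mulr_sumr; apply: eq_bigr => i _; rewrite mulrA.
Qed.

Lemma mem_ideal_gen (R : comNzRingType) (s : seq R) x :
  x \in s -> ideal_gen s x.
Proof.
move=> s_x; have lt_x : (index x s < size s)%N by rewrite index_mem.
exists (fun i => (i == Ordinal lt_x)%:R); rewrite (bigD1 (Ordinal lt_x)) //=.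
rewrite eqxx mul1r nth_index // big1 ?addr0 // => i /negPf->.
by rewrite mul0r.
Qed.

Lemma ideal_gen_min (R : comNzRingType) (s : seq R) (I : R -> Prop) :
  ideal I -> (forall x, x \in s -> I x) -> subideal (ideal_gen s) I.
Proof.
move=> I_ideal sI x [c ->]; apply: ideal_sum => // i _.
by apply: idealM => //; apply/sI/mem_nth.
Qed.

Lemma size_map_monic (R S : nzRingType) (h : {rmorphism R -> S})
    (p : {poly R}) : p \is monic -> size (map_poly h p) = size p.
Proof.
by move=> /monicP p1; rewrite size_map_poly_id0 // p1 rmorph1 oner_neq0.
Qed.

(** Division by a monic polynomial commutes with every ring morphism, so the
    equations of the curve can be specialised coefficientwise. *)
Lemma rmodp_map_monic (R S : comNzRingType) (h : {rmorphism R -> S})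
    (p d : {poly R}) : d \is monic ->
  map_poly h (Pdiv.Ring.rmodp p d) =
    Pdiv.Ring.rmodp (map_poly h p) (map_poly h d).
Proof.
move=> mon_d; have mon_hd : map_poly h d \is monic by apply: monic_map.
rewrite {2}(Pdiv.RingMonic.rdivp_eq mon_d p) rmorphD rmorphM /=.
rewrite Pdiv.RingMonic.rmodp_addl_mul_small //.
rewrite (leq_ltn_trans (size_poly _ _)) // size_map_monic //.
by rewrite Pdiv.Ring.ltn_rmodpN0 // monic_neq0.
Qed.

Lemma mpoly_generated (K : nzRingType) n (P : {mpoly K[n]} -> Prop) :
  (forall c, P c%:MP) -> (forall i, P 'X_i) ->
  (forall p q, P p -> P q -> P (p + q)) ->
  (forall p q, P p -> P q -> P (p * q)) -> forall p, P p.
Proof.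
move=> PC PX PD PM p; rewrite (mpolyE p); apply: big_ind => // [|m _].
  by rewrite -mpolyC0.
rewrite -mul_mpolyC; apply: (PM) => //; rewrite mpolyXE_id.
apply: big_ind => // [|i _]; first by rewrite -mpolyC1.
elim: (m i) => [|k IHk]; first by rewrite expr0 -mpolyC1.
by rewrite exprS; apply: PM.
Qed.

Section Coordinates.
Variables (n : nat) (R : comNzRingType).
Implicit Types (v : 'I_n.+2 -> R) (s : {poly R}).

(** A point consists of the value [a], the inverse [u] of [f(a)], and the
    coefficients of [s]. *)
Definition x_coord v := v ord0.
Definition u_coord v := v (lift ord0 ord0).
Definition s_coord v : {poly R} :=
  rVpoly (\row_(i < n) v (lift ord0 (lift ord0 i))).

Definition coords (x u : R) (s : {poly R}) (i : 'I_n.+2) : R :=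
  if unlift ord0 i is Some j then
    if unlift ord0 j is Some k then s`_k else u
  else x.

Lemma x_coords x u s : x_coord (coords x u s) = x.
Proof. by rewrite /x_coord /coords unlift_none. Qed.

Lemma u_coords x u s : u_coord (coords x u s) = u.
Proof. by rewrite /u_coord /coords liftK unlift_none. Qed.

Lemma s_coords x u s : (size s <= n)%N -> s_coord (coords x u s) = s.
Proof.
move=> size_s; rewrite /s_coord -[RHS](poly_rV_K size_s); congr rVpoly.
by apply/rowP=> i; rewrite !mxE /coords !liftK.
Qed.

Lemma size_s_coord v : (size (s_coord v) <= n)%N.
Proof. exact: size_poly. Qed.

End Coordinates.

Section Curve.
Variables (E : fieldType) (f g : {poly E}).
Hypothesis f_monic : f \is monic.
Let n := (size f).-1.

Let size_f : size f = n.+1.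
Proof. by rewrite prednK // size_poly_gt0 monic_neq0. Qed.

Section Residue.
Variables (R : comNzRingType) (j : {rmorphism E -> R}) (v : 'I_n.+2 -> R).

(** The left-hand sides of the equations, at a point with coordinates [v] in an
    arbitrary [E]-algebra [R].  Taking [R] to be the polynomial ring and [v] its
    variables yields the equations themselves; other choices yield their values
    at points and their base changes. *)
Definition unit_defect := u_coord v * (map_poly j f).[x_coord v] - 1.

Definition square_defect :=
  ('X - (x_coord v)%:P) * map_poly j g - s_coord v ^+ 2.

Definition residue := Pdiv.Ring.rmodp square_defect (map_poly j f).

Lemma size_residue : (size residue <= n)%N.
Proof.
rewrite -ltnS -size_f -(size_map_monic j f_monic).
by rewrite Pdiv.Ring.ltn_rmodpN0 // monic_neq0 // monic_map.
Qed.

Lemma residue_root x :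
  root (map_poly j f) x -> residue.[x] = square_defect.[x].
Proof.
move=> /rootP fx; have mon_jf := monic_map j f_monic.
rewrite (Pdiv.RingMonic.rdivp_eq mon_jf square_defect).
by rewrite hornerD hornerM fx mulr0 add0r.
Qed.

End Residue.

Lemma square_defect_map (R S : comNzRingType) (h : {rmorphism R -> S})
    (j : {rmorphism E -> R}) (j' : {rmorphism E -> S}) v v' :
  h \o j =1 j' -> h \o v =1 v' ->
  map_poly h (square_defect j v) = square_defect j' v'.
Proof.
move=> hj hv; rewrite /square_defect rmorphB rmorphM rmorphXn /=.
rewrite map_polyXsubC map_rVpoly -map_poly_comp (eq_map_poly hj).
have -> : h (x_coord v) = x_coord v' := hv _.
congr (_ - rVpoly _ ^+ 2); by apply/rowP=> i; rewrite !mxE; apply: hv.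
Qed.

Lemma residue_map (R S : comNzRingType) (h : {rmorphism R -> S})
    (j : {rmorphism E -> R}) (j' : {rmorphism E -> S}) v v' :
  h \o j =1 j' -> h \o v =1 v' ->
  map_poly h (residue j v) = residue j' v'.
Proof.
move=> hj hv; rewrite /residue rmodp_map_monic ?monic_map //.
by rewrite (square_defect_map hj hv) -map_poly_comp (eq_map_poly hj).
Qed.

Lemma unit_defect_map (R S : comNzRingType) (h : {rmorphism R -> S})
    (j : {rmorphism E -> R}) (j' : {rmorphism E -> S}) v v' :
  h \o j =1 j' -> h \o v =1 v' ->
  h (unit_defect j v) = unit_defect j' v'.
Proof.
move=> hj hv; rewrite /unit_defect rmorphB rmorphM rmorph1 -horner_map /=.
rewrite -map_poly_comp (eq_map_poly hj).
by rewrite (hv _ : h (x_coord v) = _) (hv _ : h (u_coord v) = _).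
Qed.

Let gen : 'I_n.+2 -> {mpoly E[n.+2]} := fun i => 'X_i.
Let const : {rmorphism E -> {mpoly E[n.+2]}} := @mpolyC n.+2 E.

Definition square_curve : affine_scheme E :=
  AffineScheme (unit_defect const gen ::
    [seq (residue const gen)`_k | k <- iota 0 n]).

(** A morphism out of the polynomial ring kills the equations exactly when the
    point that it defines lies on the curve; the residue has size at most [n],
    so the listed coefficients determine it. *)
Lemma equations_vanishP (R : comNzRingType) (j : {rmorphism E -> R})
    (v : 'I_n.+2 -> R) (h : {rmorphism {mpoly E[n.+2]} -> R}) :
  (forall c, h c%:MP = j c) -> (forall i, h 'X_i = v i) ->
  (forall p, p \in equations square_curve -> h p = 0) <->
  unit_defect j v = 0 /\ residue j v = 0.
Proof.
move=> hC hX; rewrite -(unit_defect_map (h := h) (j := const) (v := gen)) //.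
rewrite -(residue_map (h := h) (j := const) (v := gen) (v' := v)) //; split.
  move=> h0; split; first by apply: h0; rewrite mem_head.
  apply/polyP=> k; rewrite coef_map coef0 /=.
  have [lt_kn|le_nk] := ltnP k n.
    by apply: h0; rewrite inE map_f ?orbT // mem_iota.
  by rewrite nth_default ?rmorph0 // (leq_trans (size_residue _ _)).
case=> h_u /polyP h_r p; rewrite inE => /predU1P[->//|/mapP[k _ ->]].
by have := h_r k; rewrite coef_map coef0.
Qed.

Lemma residue_eq0 (L : fieldType) (j : {rmorphism E -> L}) v :
  residue j v = 0 <-> map_poly j f %| square_defect j v.
Proof. by rewrite dvdpE /Pdiv.Ring.rdvdp -/(residue j v); split=> /eqP. Qed.

(** When [f] splits, a square root of [(X - x) g] modulo [f] is found by
    interpolating square roots of the values at the distinct roots. *)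
Lemma point_of_square_roots (L : fieldType) (j : {rmorphism E -> L})
    (rs : seq L) x :
  map_poly j f = \prod_(r <- rs) ('X - r%:P) -> uniq rs ->
  (map_poly j f).[x] != 0 ->
  {in rs, forall r, exists y, y ^+ 2 = (r - x) * (map_poly j g).[r]} ->
  exists v, [/\ x_coord v = x, unit_defect j v = 0 & residue j v = 0].
Proof.
move=> f_eq uniq_rs fx_neq0 sqrt_rs.
have size_rs : size rs = n.
  apply/eqP; rewrite -eqSS -size_f -(size_map_monic j f_monic) f_eq.
  by rewrite size_prod_XsubC.
have [s size_s s_sqr] := interpolation uniq_rs sqrt_rs.
rewrite size_rs in size_s.
exists (coords x (map_poly j f).[x]^-1 s); rewrite x_coords; split=> //.
  by rewrite /unit_defect u_coords x_coords mulVf // subrr.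
apply/residue_eq0; rewrite f_eq /square_defect x_coords s_coords //.
apply: uniq_roots_dvdp; last by rewrite uniq_rootsE.
by apply/allP=> r /s_sqr s_r; rewrite /root !hornerE s_r subrr.
Qed.

Lemma rational_pointP (L : fieldType) (iota : {rmorphism E -> L}) v :
  rational_point square_curve iota v <->
  unit_defect iota v = 0 /\ residue iota v = 0.
Proof.
apply: (equations_vanishP (h := meval v \o map_mpoly iota)) => [c|i] /=.
  by rewrite map_mpolyC mevalC.
by rewrite map_mpolyX mevalXU.
Qed.

(** A square root modulo [f] may be replaced by its remainder, which has few
    enough coefficients to be a point of the curve. *)
Lemma square_curve_points (L : fieldType) (iota : {rmorphism E -> L}) :
  (exists v, rational_point square_curve iota v) <->
  (exists a : L,
     square_mod (map_poly iota f) (('X - a%:P) * map_poly iota g) /\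
     (map_poly iota f).[a] != 0).
Proof.
split=> [[v /rational_pointP[/eqP uv /residue_eq0 f_dvd]]|].
  exists (x_coord v); split; first by exists (s_coord v).
  apply: contraTneq uv => fx0.
  by rewrite /unit_defect fx0 mulr0 sub0r oppr_eq0 oner_neq0.
case=> a [[s f_dvd] fa_neq0].
have size_fL : size (map_poly iota f) = n.+1 by rewrite size_map_monic.
pose s' := s %% map_poly iota f.
have size_s' : (size s' <= n)%N.
  by rewrite -ltnS -size_fL ltn_modp -size_poly_gt0 size_fL.
exists (coords a (map_poly iota f).[a]^-1 s'); apply/rational_pointP; split.
  by rewrite /unit_defect u_coords x_coords mulVf // subrr.
apply/residue_eq0; rewrite /square_defect x_coords s_coords //.
(* [s - s'] is a multiple of [f] and divides [s ^+ 2 - s' ^+ 2] *)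
have -> : ('X - a%:P) * map_poly iota g - s' ^+ 2 =
    (('X - a%:P) * map_poly iota g - s ^+ 2) + (s - s') * (s + s') by ring.
rewrite dvdp_add // dvdp_mulr // {1}(divp_eq s (map_poly iota f)) addrK.
exact: dvdp_mull.
Qed.

(** * The curve over a splitting field *)

Section Split.
Variables (K : fieldType) (iota : {rmorphism E -> K}) (rs : seq K).
Hypothesis f_eq : map_poly iota f = \prod_(r <- rs) ('X - r%:P).
Hypothesis uniq_rs : uniq rs.

Let M : comAlgType K := {mpoly K[n.+2]}.
Let I : M -> Prop := defining_ideal (C := base_change square_curve iota).
Let X : 'I_n.+2 -> M := fun i => 'X_i.
Let a := x_coord X.
Let u := u_coord X.
Let s := s_coord X.
Let fK := map_poly iota f.
Let gK := map_poly iota g.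
Let j : {rmorphism E -> M} := @mpolyC n.+2 K \o iota.

Let I_ideal : ideal I.
Proof. exact: ideal_gen_ideal. Qed.

Let j_alg (p : {poly E}) x :
  (map_poly j p).[x] = horner_alg x (map_poly iota p).
Proof.
rewrite /horner_alg /horner_morph -map_poly_comp; congr (_.[x]).
by apply: eq_map_poly => c; rewrite /= alg_mpolyC.
Qed.

Let map_const c : map_mpoly iota c%:MP = j c.
Proof. exact: map_mpolyC. Qed.

Let map_gen i : map_mpoly iota 'X_i = X i.
Proof. exact: map_mpolyX. Qed.

Let size_rs : size rs = n.
Proof.
apply/eqP; rewrite -eqSS -size_f -(size_map_monic iota f_monic) f_eq.
by rewrite size_prod_XsubC.
Qed.

Let I_unit : I (u * horner_alg a fK - 1).
Proof.
rewrite -j_alg -/(unit_defect j X).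
rewrite -(unit_defect_map (h := map_mpoly iota) (j := const) (v := gen)) //.
by apply: mem_ideal_gen; rewrite mem_head.
Qed.

Let I_residue i : I (residue j X)`_i.
Proof.
have [lt_in|le_ni] := ltnP i n; last first.
  by rewrite nth_default ?(leq_trans (size_residue _ _)) //; apply: ideal0.
rewrite -(residue_map (h := map_mpoly iota) (j := const) (v := gen)) //.
rewrite coef_map; apply: mem_ideal_gen; rewrite inE; apply/orP; right.
by apply/map_f/map_f; rewrite mem_iota.
Qed.

Let horner_alg_scalar c (p : {poly K}) : horner_alg (c%:A : M) p = (p.[c])%:A.
Proof. by rewrite /horner_alg /horner_morph horner_map. Qed.

(** At a root of [f] the remainder takes the same value as the dividend. *)
Let I_square :
  {in rs, forall r, I (s.[r%:A] ^+ 2 - horner_alg a (branch gK r))}.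
Proof.
move=> r r_rs; rewrite -opprB; apply: idealN => //.
have -> : horner_alg a (branch gK r) - s.[r%:A] ^+ 2 = (residue j X).[r%:A].
  have f_r : root (map_poly j f) r%:A.
    rewrite /root j_alg horner_alg_scalar f_eq (rootP _) ?scale0r //.
    by rewrite root_prod_XsubC.
  rewrite residue_root // /square_defect !hornerE j_alg horner_alg_scalar.
  rewrite /branch rmorphM rmorphB /= !horner_algC horner_algX.
  by rewrite expr2.
rewrite horner_coef; apply: ideal_sum => // i _.
by rewrite mulrC; apply: idealM.
Qed.

Let B := fraction_filtration I a u fK.
Let Y r := s.[r%:A].

Let B_ring : filtered_subring B.
Proof. exact: fraction_filtration_ring. Qed.

Let B_square : {in rs, forall r, B 1 (Y r ^+ 2)}.
Proof. exact: (square_in_filtration (g := gK)). Qed.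

(** The elements with a normal form are closed under sums and products and
    include the variables: the coefficients of [s] are combinations of its
    values at the roots of [f], by [coef_from_values]. *)
Let generated x : exists D, adjoin (B D) Y rs x.
Proof.
pose P x := exists D, adjoin (B D) Y rs x.
have PD y z : P y -> P z -> P (y + z).
  move=> [D1 Hy] [D2 Hz]; exists (maxn D1 D2); apply: adjoinD => //.
    by apply: adjoin_le Hy => //; apply: leq_maxl.
  by apply: adjoin_le Hz => //; apply: leq_maxr.
have PM y z : P y -> P z -> P (y * z).
  by move=> [D1 Hy] [D2 Hz]; eexists; apply: adjoinM Hy Hz.
have PB y : B 1 y -> P y by move=> By; exists 1%N; apply: adjoin_base.
have P_poly (c : {poly K}) : (size c <= 2)%N -> P (horner_alg a c).
  move=> size_c; apply: PB; apply: fraction_filtration_poly size_c _ => //.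
  by rewrite subrr; apply: ideal0.
have PC c : P c%:A.
  rewrite -(horner_algC a); apply: P_poly.
  by rewrite (leq_trans (size_polyC_leq1 _)).
move: x; apply: (@mpoly_generated K n.+2 P) => // [c|i].
  by rewrite -alg_mpolyC; apply: PC.
case: (unliftP ord0 i) => [i1|] ->; last first.
  by rewrite -[X in P X]/a -(horner_algX a); apply: P_poly; rewrite size_polyX.
case: (unliftP ord0 i1) => [k|] ->; last first.
  by apply: PB; apply: fraction_filtration_inverse.
have -> : 'X_(lift ord0 (lift ord0 k)) = s`_k :> M.
  by rewrite coef_rVpoly_ord mxE.
apply: (@coef_from_values K M P rs s) => //.
- by rewrite -[0](scale0r 1); apply: PC.
- by move=> c y Py; rewrite -mulr_algl; apply: PM.
- by rewrite size_rs size_s_coord.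
by move=> r r_rs; exists 0%N; apply: adjoin_gen.
Qed.

Lemma split_dependence (x y : M) : exists N (c : nat -> nat -> K),
  (exists i k, [/\ (i < N)%N, (k < N)%N & c i k != 0]) /\
  I (\sum_(i < N) \sum_(k < N) c i k *: (x ^+ i * y ^+ k)).
Proof.
apply: (algebraic_dependence I_ideal B_ring _ B_square generated).
exact: fraction_filtration_spanned.
Qed.

(** Evaluation at a point of the curve above [x]; [x] may be transcendental
    over [K] (function field) or algebraic (closed point). *)
Lemma split_point (L : fieldType) (h : {rmorphism K -> L}) (x : L) :
  (map_poly h fK).[x] != 0 ->
  {in rs, forall r, exists y, y ^+ 2 = (h r - x) * h gK.[r]} ->
  exists phi : {rmorphism {mpoly K[n.+2]} -> L},
    (forall p, I p -> phi p = 0) /\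
    (forall c, phi (horner_alg a c) = (map_poly h c).[x]).
Proof.
move=> fx_neq0 sqrt_rs; pose jL := h \o iota.
have map_jL p : map_poly jL p = map_poly h (map_poly iota p).
  by rewrite -map_poly_comp.
have [||||v [vx uv rv]] := @point_of_square_roots L jL (map h rs) x.
- rewrite map_jL f_eq rmorph_prod big_map; apply: eq_bigr => r _.
  exact: map_polyXsubC.
- by rewrite map_inj_uniq //; apply: fmorph_inj.
- by rewrite map_jL.
- by move=> _ /mapP[r /sqrt_rs[y y2] ->]; exists y; rewrite map_jL horner_map.
pose phi : {rmorphism {mpoly K[n.+2]} -> L} := mmap h v.
have phiX i : phi 'X_i = v i by rewrite /phi /= mmapX mmap1U.
have phiC c : phi c%:MP = h c by rewrite /phi /= mmapC.
exists phi; split=> [p Ip|c].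
  have [||_ vanish] := @equations_vanishP L jL v (phi \o map_mpoly iota).
  - by move=> c /=; rewrite map_mpolyC phiC.
  - by move=> i /=; rewrite map_mpolyX phiX.
  apply: (ideal_gen_min (prime_ideal_ideal (prime_kernel phi))) Ip.
  by move=> _ /mapP[q q_eq ->]; apply: (vanish (conj uv rv)).
rewrite /horner_alg /horner_morph -horner_map -map_poly_comp phiX -vx.
by congr (_.[_]); apply: eq_map_poly => d; rewrite /= alg_mpolyC phiC.
Qed.

(** The point is the generic one: [x] is the variable of [K(X)], and [L]
    contains the square roots of all the branch polynomials. *)
Lemma split_function_field : 2%:R != 0 :> K ->
  {in rs, forall r, gK.[r] != 0} ->
  exists (L : fieldType) (phi : {rmorphism {mpoly K[n.+2]} -> L}),
    (forall p, I p <-> phi p = 0) /\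
    (forall c, phi (horner_alg a c) = 0 -> c = 0).
Proof.
move=> two_neq0 g_neq0; pose tofrac := @FracField.tofrac {poly K}.
have [L [h sqrt_h]] :=
  square_roots_extension [seq tofrac (branch gK r) | r <- rs].
pose hK : {rmorphism K -> L} := h \o (tofrac \o polyC).
have eval_x c : (map_poly hK c).[h (tofrac 'X)] = h (tofrac c).
  (* evaluating [c] at the variable gives back [c] *)
  rewrite (map_poly_comp h) horner_map (map_poly_comp tofrac) horner_map.
  by rewrite -[(map_poly polyC c).['X]]/(c \Po 'X) comp_polyXr.
have [||phi [phi_I phi_x]] := @split_point L hK (h (tofrac 'X)).
- rewrite eval_x fmorph_eq0 tofrac_eq0 map_poly_eq0; exact: monic_neq0.
- move=> r r_rs; have [|y y2] := sqrt_h (tofrac (branch gK r)).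
    exact: map_f.
  by exists y; rewrite y2 /branch [tofrac _]tofracM tofracB rmorphM rmorphB.
have phi_a c : phi (horner_alg a c) = h (tofrac c) by rewrite phi_x eval_x.
exists L, phi; split=> [p|c /eqP]; last first.
  by rewrite phi_a fmorph_eq0 tofrac_eq0 => /eqP.
split=> [/phi_I //|phi_p]; have [D p_adj] := generated p.
apply: (kernel_adjoin I_ideal I_unit I_square _ g_neq0 phi_I phi_a
  _ _ p_adj) => //.
by rewrite -(rmorph_nat hK) fmorph_eq0.
Qed.

Lemma split_irreducible : 2%:R != 0 :> K -> {in rs, forall r, gK.[r] != 0} ->
  prime_ideal I.
Proof.
move=> two_neq0 g_neq0.
have [L [phi [I_phi _]]] := split_function_field two_neq0 g_neq0.
split.
- exact: ideal0.
- exact: idealD.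
- exact: idealM.
- by move/I_phi/eqP; rewrite rmorph1 oner_eq0.
move=> x y /I_phi/eqP; rewrite rmorphM mulf_eq0.
by case/orP=> /eqP/I_phi; [left | right].
Qed.

End Split.
End Curve.

(** * Descent to the base field *)

Lemma retract_mpolyM (E K : fieldType) (iota : {rmorphism E -> K})
    (lambda : {additive K -> E}) n (p : {mpoly E[n]}) (q : {mpoly K[n]}) :
  (forall c x, lambda (iota c * x) = c * lambda x) ->
  map_mpoly lambda (map_mpoly iota p * q) = p * map_mpoly lambda q.
Proof.
move=> lambdaM; apply/mpolyP => m.
rewrite mcoeff_map_mpoly !mcoeffM raddf_sum; apply: eq_bigr => k _.
by rewrite !mcoeff_map_mpoly lambdaM.
Qed.

(** Applying the retraction to all coefficients is linear over the polynomials
    with coefficients in [E], hence turns a combination of the generators over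
    [K] into one over [E]. *)
Lemma retract_ideal_gen (E K : fieldType) (iota : {rmorphism E -> K})
    (lambda : {additive K -> E}) n (s : seq {mpoly E[n]}) x :
  (forall c x, lambda (iota c * x) = c * lambda x) ->
  ideal_gen [seq map_mpoly iota p | p <- s] x ->
  ideal_gen s (map_mpoly lambda x).
Proof.
move=> lambdaM [c ->]; rewrite raddf_sum; have idE := ideal_gen_ideal s.
apply: ideal_sum => // i _.
have lt_i : (i < size s)%N by rewrite -(size_map (map_mpoly iota)).
rewrite (nth_map 0) // mulrC /= (retract_mpolyM _ _ lambdaM) // mulrC.
by apply: idealM => //; apply/mem_ideal_gen/mem_nth.
Qed.

Lemma separable_split_uniq (E K : fieldType) (iota : {rmorphism E -> K}) f rs :
  separable_poly f -> map_poly iota f = \prod_(r <- rs) ('X - r%:P) -> uniq rs.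
Proof.
by move=> sep_f f_eq; rewrite -separable_prod_XsubC -f_eq separable_map.
Qed.

Lemma coprime_root_neq0 (E K : fieldType) (iota : {rmorphism E -> K})
    (f g : {poly E}) rs :
  coprimep g f -> map_poly iota f = \prod_(r <- rs) ('X - r%:P) ->
  {in rs, forall r, (map_poly iota g).[r] != 0}.
Proof.
move=> cop f_eq r r_rs.
apply: (@coprimep_root _ (map_poly iota f) (map_poly iota g)).
  by rewrite coprimep_map coprimep_sym.
by rewrite f_eq root_prod_XsubC.
Qed.

Lemma morph_two_neq0 (E K : fieldType) (iota : {rmorphism E -> K}) :
  2%N \notin [pchar E] -> 2%:R != 0 :> K.
Proof.
by rewrite inE /= => two_neq0; rewrite -(rmorph_nat iota) fmorph_eq0.
Qed.

Section Monic.
Variables (E : fieldType) (f g : {poly E}).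
Hypothesis char_E : 2%N \notin [pchar E].
Hypothesis f_monic : f \is monic.
Hypothesis f_separable : separable_poly f.
Hypothesis g_coprime_f : coprimep g f.

Let n := (size f).-1.
Let C := square_curve f g.

Lemma square_curve_absolutely_irreducible : absolutely_irreducible C.
Proof.
move=> K iota _; have [rs f_eq] := closed_field_poly_normal (map_poly iota f).
rewrite (monicP (monic_map iota f_monic)) scale1r in f_eq.
apply: (split_irreducible f_monic f_eq).
- exact: separable_split_uniq f_eq.
- exact: morph_two_neq0 iota char_E.
- exact: coprime_root_neq0 f_eq.
Qed.

Lemma separable_splitting_extension :
  exists (K : fieldType) (iota : {rmorphism E -> K}) (rs : seq K),
    retractable iota /\ map_poly iota f = \prod_(r <- rs) ('X - r%:P).
Proof.
have [K [iota [ret [rs f_eqp]]]] := splitting_extension (monic_neq0 f_monic).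
exists K, iota, rs; split=> //; apply/eqP; rewrite -eqp_monic //.
  exact: monic_map.
exact: monic_prod_XsubC.
Qed.

(** A relation over [K] between elements defined over [E] is scaled to have a
    coefficient equal to [1] before it is retracted, so that the relation
    obtained over [E] is not zero. *)
Lemma square_curve_dim_le1 d :
  prime_chain (defining_ideal (C := C)) d -> (d <= 1)%N.
Proof.
have [K [iota [rs [[lambda [lambda1 lambdaM]] f_eq]]]] :=
  separable_splitting_extension.
apply: dependent_krull_dim_le1 => x y.
have uniq_rs := separable_split_uniq f_separable f_eq.
have [N [c [[i0 [k0 [lt_i lt_k c_neq0]]] Ic]]] :=
  split_dependence g f_monic f_eq uniq_rs (map_mpoly iota x) (map_mpoly iota y).
exists N, (fun i k => lambda ((c i0 k0)^-1 * c i k)); split.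
  by exists i0, k0; rewrite mulVf // lambda1 oner_neq0.
have := retract_ideal_gen lambdaM
  (idealM (ideal_gen_ideal _) (c i0 k0)^-1%:MP Ic).
congr (ideal_gen _ _); rewrite mulr_sumr raddf_sum; apply: eq_bigr => i _.
rewrite mulr_sumr raddf_sum; apply: eq_bigr => k _ /=.
rewrite mul_mpolyC scalerA -!rmorphXn -rmorphM.
apply/mpolyP => m; rewrite mcoeff_map_mpoly !mcoeffZ mcoeff_map_mpoly.
by rewrite mulrC lambdaM mulrC.
Qed.

(** The smaller prime is the kernel of the generic point and the larger one
    that of a closed point above a root [z] of [q = f X + 1].  Such a root is
    not a root of [f], and [q(a)] lies in the larger prime only. *)
Lemma square_curve_prime_chain : prime_chain (defining_ideal (C := C)) 1.
Proof.
have [K [iota [rs [_ f_eq]]]] := separable_splitting_extension.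
have uniq_rs := separable_split_uniq f_separable f_eq.
have [L [phi [I_phi phi_a]]] := split_function_field f_monic f_eq uniq_rs
  (morph_two_neq0 iota char_E) (coprime_root_neq0 g_coprime_f f_eq).
pose q := f * 'X + 1.
have f_gt0 : (0 < size f)%N by rewrite size_poly_gt0 monic_neq0.
have size_q : (1 < size (map_poly iota q))%N.
  rewrite size_map_poly size_polyDl size_mulX ?monic_neq0 // size_poly1 ltnS //.
have [K1 [z qz]] := adjoin_root size_q.
pose i1 : {rmorphism K -> K1} := in_alg K1.
have [K2 [i2 sqrt_i2]] := square_roots_extension
  [seq (i1 r - z) * i1 (map_poly iota g).[r] | r <- rs].
pose h : {rmorphism K -> K2} := i2 \o i1.
have map_h p : (map_poly h p).[i2 z] = i2 (map_poly i1 p).[z].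
  by rewrite -horner_map -map_poly_comp.
have [||psi [psi_I psi_x]] :=
  @split_point _ _ g f_monic _ _ _ f_eq uniq_rs K2 h (i2 z).
- rewrite map_h fmorph_eq0; apply: contraTneq qz => fz0.
  rewrite rmorphD rmorphM rmorph1 /= map_polyX rmorphD rmorphM rmorph1 /=.
  by rewrite map_polyX /root !hornerE fz0 mul0r add0r oner_neq0.
- move=> r r_rs.
  have [|y y2] := sqrt_i2 ((i1 r - z) * i1 (map_poly iota g).[r]).
    by apply/mapP; exists r.
  by exists y; rewrite y2 rmorphM rmorphB.
pose base : {rmorphism {mpoly E[n.+2]} -> {mpoly K[n.+2]}} := map_mpoly iota.
have base_I p : defining_ideal (C := C) p -> phi (base p) = 0.
  move=> Cp; apply/I_phi; move: p Cp.
  apply: (ideal_gen_min (I := fun p => ideal_gen _ (base p))).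
    have idK := ideal_gen_ideal [seq map_mpoly iota p | p <- equations C].
    split=> [|x y Ix Iy|x y Iy]; first by rewrite rmorph0; apply: ideal0.
      by rewrite rmorphD; apply: idealD.
    by rewrite rmorphM; apply: idealM.
  by move=> p Cp; apply/mem_ideal_gen/map_f.
exists (fun i : 'I_2 => if i == ord0 then (fun p => phi (base p) = 0)
                        else (fun p => psi (base p) = 0)).
have le01 p : phi (base p) = 0 -> psi (base p) = 0 by move/I_phi/psi_I.
split.
- move=> i; case: ifP => _; first exact: (prime_kernel (phi \o base)).
  exact: (prime_kernel (psi \o base)).
- by move=> i p /base_I p0; case: ifP => _; [|apply: le01].
move=> i k lt_ik.
have -> : i = ord0.
  apply/eqP; rewrite -val_eqE /= -leqn0 -ltnS.
  exact: leq_trans lt_ik (ltn_ord k).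
have -> : (k == ord0) = false by apply/negP => /eqP k0; rewrite k0 in lt_ik.
rewrite eqxx; split=> // sub10.
pose w : {mpoly E[n.+2]} := horner_alg ('X_ord0) q.
have base_w : base w = horner_alg ('X_ord0) (map_poly iota q).
  rewrite /w /horner_alg /horner_morph -horner_map /= -!map_poly_comp.
  rewrite map_mpolyX.
  by congr (_.[_]); apply: eq_map_poly => c; rewrite /= !alg_mpolyC map_mpolyC.
have : psi (base w) = 0.
  by rewrite base_w psi_x map_h (rootP qz) rmorph0.
by move/sub10; rewrite base_w => /phi_a q0; rewrite q0 size_poly0 in size_q.
Qed.

Lemma square_curve_monic :
  [/\ is_curve C, absolutely_irreducible C
    & forall (E' : fieldType) (iota : {rmorphism E -> E'}),
        (exists v, rational_point C iota v) <->
        (exists a : E',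
           square_mod (map_poly iota f) (('X - a%:P) * map_poly iota g) /\
           (map_poly iota f).[a] != 0)].
Proof.
split.
- split; [exact: square_curve_prime_chain | exact: square_curve_dim_le1].
- exact: square_curve_absolutely_irreducible.
- by move=> E' iota; apply: square_curve_points.
Qed.

End Monic.

(** Dividing [f] by its leading coefficient changes neither its multiples nor
    its roots. *)
Theorem theorem8p5 (E : fieldType) (char_E : 2%N \notin [pchar E])
    (f : {poly E}) (f_nonconstant : (1 < size f)%N)
    (f_separable : separable_poly f)
    (g : {poly E}) (g_coprime_f : coprimep g f) :
  exists C : affine_scheme E,
    [/\ is_curve C,
        absolutely_irreducible C
      & forall (E' : fieldType) (iota : {rmorphism E -> E'}),
          (exists v, rational_point C iota v) <->
          (exists a : E',
             square_mod (map_poly iota f) (('X - a%:P) * map_poly iota g) /\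
             (map_poly iota f).[a] != 0)].
Proof.
have f_neq0 : f != 0 by rewrite -size_poly_gt0 ltnW.
have c_neq0 : (lead_coef f)^-1 != 0 by rewrite invr_eq0 lead_coef_eq0.
pose f1 := (lead_coef f)^-1 *: f.
have f1_f : f1 %= f by apply: eqp_scale.
have f1_monic : f1 \is monic.
  by rewrite monicE lead_coefZ mulVf // lead_coef_eq0.
have f1_sep : separable_poly f1 by rewrite (eqp_separable f1_f).
have g_f1 : coprimep g f1 by rewrite (eqp_coprimepr _ f1_f).
have [C1 C2 C3] := square_curve_monic char_E f1_monic f1_sep g_f1.
exists (square_curve f1 g); split=> // E' iota.
split=> [/C3[a [[s f1s] f1a]]|[a [[s fs] fa]]].
  exists a; split; last first.
    by move: f1a; rewrite /f1 map_polyZ hornerZ mulf_eq0 negb_or => /andP[].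
  by exists s; rewrite -(eqp_dvdl _ (_ : map_poly iota f1 %= _)) ?eqp_map.
apply/C3; exists a; split.
  have f1_fL : map_poly iota f1 %= map_poly iota f by rewrite eqp_map.
  by exists s; rewrite (eqp_dvdl _ f1_fL).
by rewrite /f1 map_polyZ hornerZ mulf_neq0 // fmorph_eq0.
Qed.
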